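(* Let $d, k \geq 1$ be integers with $k \geq d+1$, and let $\epsilon > 0$. There is a constant $C$ depending only on $d$, $k$ and $\epsilon$ such that for every graph $G$ with $n \geq 2$ vertices and maximum average degree $d - \epsilon$, the reconfiguration graph $R_k(G)$ is connected and has diameter at most $C\, n (\log n)^{d-1}$.
   Context: All graphs are finite and simple. A $k$-coloring of a graph $G$ is a function $f: V(G) \to \{1,\dots,k\}$ with $f(u) \neq f(v)$ for every edge $uv$. The reconfiguration graph $R_k(G)$ has as vertex set all $k$-colorings of $G$, two colorings being adjacent if they differ in the color of exactly one vertex of $G$. The maximum average degree of $G$ is $\max\{2|E(H)|/|V(H)| : H \subseteq G\}$. The paper states the bound as $O(n(\log n)^{d-1})$; here the implied constant is taken to depend only on the fixed parameters $d,k,\epsilon$. *)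

(* Defs.v *)
From HB Require Import structures.
From mathcomp Require Import all_boot all_order all_algebra.

Set Implicit Arguments.
Unset Strict Implicit.
Unset Printing Implicit Defensive.

Import Order.TTheory GRing.Theory Num.Theory.

Record sgraph := SGraph {
  vertex :> finType;
  adj : rel vertex;
  adj_sym : symmetric adj;
  adj_irrefl : irreflexive adj
}.

Section Graph.
Variable G : sgraph.

Definition edges : {set {set G}} :=
  [set E : {set G} | [exists u : G, exists v : G, adj u v && (E == [set u; v])]].

(* A nonempty subgraph of G, given by its vertex set and its edge set; it need
   not be induced. *)
Definition is_subgraph (S : {set G}) (F : {set {set G}}) : bool :=
  [&& S != set0, F \subset edges & [forall E in F, E \subset S]].

(* The value 0 of the empty maximum is the correct one for a graph with at least one
   vertex, as every ratio is nonnegative. *)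
Definition max_avg_degree (R : realFieldType) : R :=
  \big[Num.max/0%R]_(H : {set G} * {set {set G}} | is_subgraph H.1 H.2)
    ((2 * #|H.2|)%:R / #|H.1|%:R)%R.

Definition graph_connected : Prop :=
  (0 < #|G|)%N /\ forall x y : G, connect (@adj G) x y.

Definition has_walk (x y : G) (m : nat) : bool :=
  [exists p : m.-tuple G, path (@adj G) x p && (last x p == y)].

(* A shortest walk has fewer than #|G| edges; the default value #|G| is taken
   only by pairs of vertices in different components. *)
Definition distance (x y : G) : nat :=
  \big[minn/#|G|]_(m < #|G| | has_walk x y m) m.

Definition diameter : nat := \max_(x : G) \max_(y : G) distance x y.

Definition is_coloring (k : nat) (f : {ffun G -> 'I_k}) : bool :=
  [forall u : G, forall v : G, adj u v ==> (f u != f v)].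

Definition coloring (k : nat) : finType := {f : {ffun G -> 'I_k} | is_coloring f}.

Definition recolor (k : nat) : rel (coloring k) :=
  fun f g => #|[pred v : G | val f v != val g v]| == 1%N.

Lemma recolor_sym k : symmetric (@recolor k).
Proof.
move=> f g; rewrite /recolor; congr (_ == _).
by apply: eq_card => v; rewrite !inE eq_sym.
Qed.

Lemma recolor_irrefl k : irreflexive (@recolor k).
Proof.
by move=> f; rewrite /recolor eq_card0 // => v; rewrite !inE eqxx.
Qed.

Definition reconfiguration_graph (k : nat) : sgraph :=
  SGraph (@recolor_sym k) (@recolor_irrefl k).

End Graph.

(* Main.v *)
Require Import Defs.
From HB Require Import structures.
From mathcomp Require Import all_boot all_order all_algebra.
From mathcomp Require Import zify.
Set Implicit Arguments.
Unset Strict Implicit.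
Unset Printing Implicit Defensive.
Import Order.TTheory GRing.Theory Num.Theory.

(* Peeling off the vertices of degree less than d, which form a fixed proportion of
   every subgraph, splits the graph into s = O(log n) layers such that every vertex
   has fewer than d neighbors in its own and later layers. It remains to join any two
   colorings by O(n s^(d-1)) recolorings, by induction on d.

   Let I be the independent set of the vertices taken greedily, last layer first. Each
   vertex outside I has a neighbor in I in its own or a later layer. Once I has color
   a, the rest uses one color less and has one relevant neighbor less, and induction
   applies. So it suffices to rid a coloring of the color a, layer by layer. If the
   earlier layers L avoid a, let K be the class of a in the next layer, and choose
   greedily new colors other than a on L and K. The greedy independent set I of L,
   taken among the vertices not adjacent to color a, is painted a; by induction L \ I
   is moved to its new colors, which do not conflict with color a on K and I; then K,
   and then I, receive theirs. One layer thus costs O(n s^(d-2)) steps. *)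

(** * Recoloring sequences *)

Section Reach.
Variables (G : sgraph) (k : nat).
Implicit Types (f g h : {ffun G -> 'I_k}) (S I M K N : {set G}).
Implicit Types (A B : {set 'I_k}) (a : 'I_k).

Lemma is_coloringP f :
  reflect (forall u v, adj u v -> f u != f v) (is_coloring f).
Proof.
apply: (iffP forallP) => [H u v uv|H u].
  by have /forallP/(_ v)/implyP := H u; apply.
by apply/forallP => v; apply/implyP; apply: H.
Qed.

(** The index only bounds the number of recolorings from above, since [reach_refl] holds for every
    [n]. Plain functions replace elements of [coloring], so that properness can be proved
    separately. *)
Inductive reach : nat -> {ffun G -> 'I_k} -> {ffun G -> 'I_k} -> Prop :=
| reach_refl n f : reach n f f
| reach_step n f g h : is_coloring f -> is_coloring g ->
    #|[pred v | f v != g v]| = 1 -> reach n g h -> reach n.+1 f h.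

Lemma reach_leq m n f g : m <= n -> reach m f g -> reach n f g.
Proof.
move=> le_mn H; elim: H n le_mn => {m f g} [m f|m f g h cf cg fg _ IH] n le_mn.
  exact: reach_refl.
by case: n le_mn => // n le_mn; apply: reach_step cf cg fg (IH _ le_mn).
Qed.

Lemma reach_trans m n f g h : reach m f g -> reach n g h -> reach (m + n) f h.
Proof.
move=> H; elim: H h => {m f g} [m f|m f g g' cf cg fg _ IH] h gh.
  exact: reach_leq (leq_addl _ _) gh.
by rewrite addSn; apply: reach_step cf cg fg (IH _ gh).
Qed.

Lemma reach_sym n f g : reach n f g -> reach n g f.
Proof.
elim=> {n f g} [n f|n f g h cf cg fg _ IH]; first exact: reach_refl.
rewrite -addn1; apply: reach_trans IH _.
apply: reach_step cg cf _ (reach_refl 0 f).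
by rewrite -fg; apply: eq_card => v; rewrite !inE eq_sym.
Qed.

(* Every mixture of f and g is proper, so the vertices of S can be recolored in
   any order. *)
Lemma reach_independent S f g :
  is_coloring f -> is_coloring g -> {in S &, forall u v, ~~ adj u v} ->
  (forall v, v \notin S -> f v = g v) -> reach #|S| f g.
Proof.
move: {2}#|S| (erefl #|S|) => n; elim: n S f => [|n IH] S f.
  move/eqP; rewrite cards_eq0 => /eqP -> _ _ _ fg; rewrite cards0.
  suff -> : f = g by apply: reach_refl.
  by apply/ffunP => v; rewrite fg ?inE.
move=> cardS cf cg indS fg.
have /set0Pn[w wS] : S != set0 by rewrite -cards_eq0 cardS.
have cardSw : #|S :\ w| = n by move: cardS; rewrite (cardsD1 w) wS => -[].
have [fgw|fgw] := eqVneq (f w) (g w).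
  apply: (@reach_leq n); first by rewrite cardS.
  rewrite -cardSw; apply: IH => //.
    by move=> u v /setD1P[_ uS] /setD1P[_ vS]; apply: indS.
  move=> v; rewrite !inE negb_and negbK => /orP[/eqP->//|]; exact: fg.
have /is_coloringP pf := cf; have /is_coloringP pg := cg.
pose f' := [ffun v => if v == w then g w else f v].
have fg' v : adj w v -> f v = g v.
  by move=> wv; apply: fg; apply: contraL wv => /(indS _ _ wS).
have cf' : is_coloring f'.
  apply/is_coloringP => u v uv; rewrite !ffunE.
  have [eu|nu] := eqVneq u w; have [ev|nv] := eqVneq v w.
  - by move: uv; rewrite eu ev adj_irrefl.
  - by move: uv; rewrite eu => uv; rewrite fg' //; apply: pg.
  - by move: uv; rewrite ev => uv; rewrite fg' 1?adj_sym //; apply: pg.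
  - exact: pf.
rewrite cardS; apply: (reach_step cf cf').
  rewrite -(card1 w); apply: eq_card => v; rewrite !inE ffunE.
  by case: (eqVneq v w) => [->|]; rewrite ?eqxx.
rewrite -cardSw; apply: IH => //.
  by move=> u v /setD1P[_ uS] /setD1P[_ vS]; apply: indS.
move=> v; rewrite !inE negb_and negbK ffunE.
by case: eqVneq => [->|_] //= /fg.
Qed.

(** * Greedy choices along the layers *)

Variable l : G -> nat.

(* The vertices outside M keep their colors, so such a neighbor only matters if its
   color belongs to the palette A. *)
Definition back_nbrs (A : {set 'I_k}) f M v : {set G} :=
  [set u | adj v u && (if u \in M then l v <= l u else f u \in A)].

(** Vertices are decided in decreasing order of [l]. A vertex [w] of least [l] comes last and joins
    [I] unless it has a neighbor in [K] or in [I]; a neighbor in [I] then has layer at least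
    [l w]. *)
Lemma dominating_set_exists M K :
  exists I, [/\ I \subset M, {in I &, forall u v, ~~ adj u v},
    {in I & K, forall u v, ~~ adj u v} &
    {in M :\: I, forall v, exists u, adj v u &&
      ((u \in K) || (u \in I) && (l v <= l u))}].
Proof.
move: {2}#|M| (erefl #|M|) => n; elim: n M => [|n IH] M cardM.
  move/eqP: cardM; rewrite cards_eq0 => /eqP ->; exists set0.
  by split=> [|u v|u v|v]; rewrite ?inE.
have /set0Pn[w0 w0M] : M != set0 by rewrite -cards_eq0 cardM.
case: (arg_minnP l w0M) => w wM' minw; have wM : w \in M := wM'.
have cardMw : #|M :\ w| = n by move: cardM; rewrite (cardsD1 w) wM => -[].
have [I [sIM indI indIK domI]] := IH _ cardMw.
have sIM' : I \subset M by apply: subset_trans sIM (subsetDl _ _).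
have [/existsP[u /andP[wu uIK]]|/existsPn nw] :=
  boolP [exists u, adj w u && ((u \in K) || (u \in I))].
  exists I; split=> // v; rewrite inE => /andP[vI vM].
  have [->|nvw] := eqVneq v w; last by apply: domI; rewrite !inE vI nvw.
  exists u; rewrite wu; case/orP: uIK => [->//|uI].
  by rewrite uI minw ?orbT //; apply: (subsetP sIM').
have nwK v : adj w v -> v \notin K by move=> wv; move: (nw v); rewrite wv; case/norP.
have nwI v : adj w v -> v \notin I by move=> wv; move: (nw v); rewrite wv; case/norP.
exists (w |: I); split.
- by rewrite subUset sub1set wM.
- move=> u v /setU1P[->|uI] /setU1P[->|vI].
  + by rewrite adj_irrefl.
  + by apply: contraL vI; apply: nwI.
  + by rewrite adj_sym; apply: contraL uI; apply: nwI.
  + exact: indI.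
- move=> u v /setU1P[->|uI] vK; last exact: indIK.
  by apply: contraL vK; apply: nwK.
- move=> v; rewrite !inE negb_or -andbA => /and3P[nvw vI vM].
  have [|u /andP[vu H]] := domI v; first by rewrite !inE vI nvw.
  exists u; rewrite vu /=; case/orP: H => [->//|/andP[uI lu]].
  by rewrite !inE uI lu !orbT.
Qed.

(** Colors are chosen in decreasing order of [l]. Once a vertex [w] of largest [l] is colored, it
    counts as an outside vertex; it was already a back neighbor of each adjacent vertex of [M], so
    no count grows. *)
Lemma greedy_coloring_exists (A : {set 'I_k}) M f :
  {in M, forall v, #|back_nbrs A f M v| < #|A|} ->
  exists g, [/\ forall v, v \notin M -> g v = f v,
    {in M, forall v, g v \in A} &
    {in M, forall v u, adj v u -> g v != g u}].
Proof.
move: {2}#|M| (erefl #|M|) => n; elim: n M f => [|n IH] M f cardM degM.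
  move/eqP: cardM; rewrite cards_eq0 => /eqP ->; exists f.
  by split=> // v; rewrite inE.
have /set0Pn[w0 w0M] : M != set0 by rewrite -cards_eq0 cardM.
case: (arg_maxnP l w0M) => w wM' maxw; have wM : w \in M := wM'.
have cardMw : #|M :\ w| = n by move: cardM; rewrite (cardsD1 w) wM => -[].
(* Only neighbors outside [M] constrain [c]; those in [M] are colored later and avoid it. *)
have /subsetPn[c cA cN] : ~~ (A \subset f @: (back_nbrs A f M w :\: M)).
  apply: contraL (degM w wM) => /subset_leq_card sA; rewrite -leqNgt.
  apply: leq_trans sA _; apply: leq_trans (leq_imset_card _ _) _.
  by apply: subset_leq_card; apply: subsetDl.
pose f' := [ffun v => if v == w then c else f v].
have [|g [gf gA gp]] := IH _ f' cardMw.
  move=> v; rewrite !inE => /andP[nvw vM]; apply: leq_ltn_trans (degM v vM).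
  apply: subset_leq_card; apply/subsetP => u; rewrite !inE ffunE => /andP[-> /=].
  case: eqVneq => [->|] //= _.
  by rewrite wM; apply: maxw.
have gw : g w = c by rewrite gf ?inE ?eqxx // ffunE eqxx.
exists g; split.
- move=> v vM; rewrite gf ?inE ?negb_and ?vM ?orbT // ffunE.
  by case: eqVneq vM => // ->; rewrite wM.
- move=> v vM; have [->|nvw] := eqVneq v w; first by rewrite gw.
  by apply: gA; rewrite !inE nvw.
move=> v vM u vu; have [ev|nvw] := eqVneq v w; last by apply: gp; rewrite // !inE nvw.
have nuw : u != w by apply: contraTneq vu => ->; rewrite ev adj_irrefl.
have [uM|uM] := boolP (u \in M).
  by rewrite eq_sym; apply: gp; rewrite ?inE ?nuw // adj_sym.
rewrite ev gw gf ?inE ?negb_and ?uM ?orbT // ffunE (negbTE nuw).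
apply: contraNneq cN => ec; rewrite {1}ec; apply: imset_f.
by rewrite !inE (negbTE uM) -ev vu -ec.
Qed.

Lemma back_nbrs_proper A B M N f g v u :
  back_nbrs B g N v \subset back_nbrs A f M v ->
  u \in back_nbrs A f M v -> u \notin back_nbrs B g N v ->
  #|back_nbrs B g N v| < #|back_nbrs A f M v|.
Proof.
by move=> sub uM uN; apply: proper_card; apply/properP; split=> //; exists u.
Qed.

(** * Painting an independent set and the induction on the number of back neighbors *)

Definition paint I (a : 'I_k) f : {ffun G -> 'I_k} :=
  [ffun v => if v \in I then a else f v].

Lemma is_coloring_paint I a f :
  is_coloring f -> {in I &, forall u v, ~~ adj u v} ->
  {in I, forall u v, adj u v -> v \notin I -> f v != a} ->
  is_coloring (paint I a f).
Proof.
move=> /is_coloringP pf indI Ia; apply/is_coloringP => u v uv; rewrite !ffunE.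
have [uI|uI] := ifPn; have [vI|vI] := ifPn.
- by rewrite (negbTE (indI _ _ uI vI)) in uv.
- by rewrite eq_sym; apply: (Ia u).
- by apply: (Ia v) => //; rewrite adj_sym.
- exact: pf.
Qed.

Lemma reach_paint I a f :
  is_coloring f -> is_coloring (paint I a f) ->
  {in I &, forall u v, ~~ adj u v} -> reach #|I| f (paint I a f).
Proof.
move=> cf cp indI; apply: reach_independent => // v vI.
by rewrite ffunE (negbTE vI).
Qed.

Definition movable (A : {set 'I_k}) M s d f :=
  [/\ is_coloring f, {in M, forall v, f v \in A}, {in M, forall v, l v < s} &
      {in M, forall v, #|back_nbrs A f M v| < d}].

(** The induction statement, with cost [t] per vertex of [M]. It ranges over [A] and [M] because
    each descent in [d] removes a color and an independent set. *)
Definition within_reach d s t := forall (A : {set 'I_k}) M f g,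
  d < #|A| -> movable A M s d f -> movable A M s d g ->
  (forall v, v \notin M -> f v = g v) -> reach (#|M| * t) f g.

Lemma back_nbrs_eq A M f g v : (forall u, u \notin M -> f u = g u) ->
  back_nbrs A f M v = back_nbrs A g M v.
Proof.
by move=> fg; apply/setP => u; rewrite !inE; case: ifPn => // /fg ->.
Qed.

Definition dominates I M a f :=
  [/\ I \subset M, {in I &, forall u v, ~~ adj u v},
    {in I, forall u v, adj u v -> v \notin M -> f v != a} &
    {in M :\: I, forall v, exists u, adj v u &&
      ((u \notin M) && (f u == a) || (u \in I) && (l v <= l u))}].

Lemma dominates_exists M a f : exists I, dominates I M a f.
Proof.
have [I [sI indI IK dom]] :=
  dominating_set_exists M [set u | (u \notin M) && (f u == a)].
exists I; split=> // [u uI v uv vM|v vMI].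
  apply: contraL uv => fv; apply: IK => //; by rewrite !inE vM fv.
by have [u] := dom v vMI; rewrite inE; exists u.
Qed.

(* Vertices of M outside I lose the color a, but also a neighbor: the one of
   color a that dominates them. *)
Lemma reach_paint_within d s t A M I a f g : within_reach d s t ->
  d.+1 < #|A| -> a \in A -> movable A M s d.+1 f -> is_coloring g ->
  (forall v, v \notin M -> f v = g v) ->
  {in M, forall v, f v != a} -> {in M, forall v, g v \in A :\ a} ->
  dominates I M a f ->
  is_coloring (paint I a g) /\ reach (#|M| * t.+1) f (paint I a g).
Proof.
move=> Hd dA aA [cf fA lM deg] cg fg fa ga [sI indI IM dom].
have cpaint h : is_coloring h -> (forall v, v \notin M -> f v = h v) ->
    {in M, forall v, h v != a} -> is_coloring (paint I a h).
  move=> ch fh ha; apply: is_coloring_paint => // u uI v uv vI.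
  have [vM|vM] := boolP (v \in M); first exact: ha.
  by rewrite -fh //; apply: (IM u).
have cpf : is_coloring (paint I a f) by apply: cpaint.
have cpg : is_coloring (paint I a g).
  by apply: cpaint => // v /ga; rewrite !inE => /andP[].
split=> //; rewrite mulnS.
apply: (@reach_leq (#|I| + #|M :\: I| * t)).
  by rewrite leq_add ?leq_mul ?subset_leq_card ?subsetDl.
apply: reach_trans (reach_paint cf cpf indI) _.
have fgI v : v \notin M :\: I -> paint I a f v = paint I a g v.
  by rewrite !inE !ffunE negb_and negbK; case: ifP => //= _ /fg.
have dMI : {in M :\: I, forall v,
    #|back_nbrs (A :\ a) (paint I a f) (M :\: I) v| < d}.
  move=> v vMI; have vM : v \in M by case/setDP: vMI.
  rewrite -ltnS; apply: leq_trans (deg v vM).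
  have [u /andP[vu du]] := dom v vMI.
  apply: (@back_nbrs_proper A (A :\ a) M (M :\: I) _ _ _ u).
  - apply/subsetP => x; rewrite !inE ffunE => /andP[-> /=].
    have [xI|xI] := boolP (x \in I); first by rewrite eqxx.
    by rewrite /=; case: ifP => // _ /andP[].
  - rewrite !inE vu; case/orP: du => [/andP[uM /eqP->]|/andP[uI lu]].
      by rewrite (negbTE uM).
    by rewrite (subsetP sI).
  - rewrite !inE vu ffunE; case/orP: du => [/andP[uM /eqP fu]|/andP[uI lu]].
      by rewrite (negbTE uM) andbF fu if_same eqxx.
    by rewrite uI eqxx.
apply: (Hd (A :\ a)) => //.
- by move: dA; rewrite (cardsD1 a A) aA.
- split=> // v /setDP[vM vI]; last exact: lM.
  by rewrite ffunE (negbTE vI) !inE fa ?fA.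
- split=> // v vMI; have /setDP[vM vI] := vMI; last 2 first.
  + exact: lM.
  + by rewrite -(back_nbrs_eq _ _ fgI) dMI.
  by rewrite ffunE (negbTE vI) ga.
Qed.

(** Induction on the number [s] of layers; [s0] stays fixed, as the hypothesis for [d] is available
    for [s0] layers only. *)
Lemma avoid_color d s0 t A M s a f : within_reach d s0 t -> s <= s0 ->
  d.+1 < #|A| -> a \in A -> movable A M s d.+1 f ->
  exists g, [/\ is_coloring g, forall v, v \notin M -> g v = f v,
    {in M, forall v, g v \in A :\ a} & reach (#|M| * (s * (t + 3))) f g].
Proof.
move=> Hd + dA aA; elim: s M f => [|s IH] M f le_s [cf fA lM deg].
  exists f; split=> //; last exact: reach_refl.
  by move=> v /lM.
pose L := [set v in M | l v < s].
have sLM : L \subset M by apply/subsetP => v; rewrite inE => /andP[].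
have lL u : u \in M -> u \notin L -> l u = s.
  by move=> uM; rewrite inE uM /= -leqNgt; move: (lM u uM); lia.
(* A vertex of [M] outside [L] lies in the last layer, so it is a back neighbor in [M] of every
   adjacent vertex of [M], whatever its color. *)
have subL h N v : L \subset N -> N \subset M -> v \in M ->
    (forall u, u \notin M -> h u = f u) ->
    back_nbrs A h N v \subset back_nbrs A f M v.
  move=> sLN sNM vM hf; apply/subsetP => u; rewrite !inE => /andP[-> /=].
  have [uN|uN] := ifPn; first by rewrite (subsetP sNM).
  have [uM|uM] := ifPn; last by rewrite hf.
  move=> _; rewrite (lL u uM); first by rewrite -ltnS lM.
  by apply: contra uN; apply: (subsetP sLN).
have [f1 [cf1 f1f f1L reach1]] : exists g, [/\ is_coloring g,
    forall v, v \notin L -> g v = f v, {in L, forall v, g v \in A :\ a} &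
    reach (#|L| * (s * (t + 3))) f g].
  apply: IH; first exact: ltnW.
  split=> // v vL; have vM := subsetP sLM v vL.
  - exact: fA.
  - by move: vL; rewrite inE => /andP[].
  - by apply: leq_trans (deg v vM); rewrite ltnS subset_leq_card // subL.
have f1M v : v \notin M -> f1 v = f v.
  by move=> vM; apply: f1f; apply: contra vM; apply: (subsetP sLM).
have f1A v : v \in M -> f1 v \in A.
  move=> vM; have [/f1L|vL] := boolP (v \in L); first by rewrite inE => /andP[].
  by rewrite f1f ?fA.
have /is_coloringP pf1 := cf1.
pose K := [set v in M | f1 v == a].
(* There are at most [d] back neighbors and more than [d] colors other than [a]. *)
have [gam [gamf gamA gamp]] : exists g, [/\ forall v, v \notin L :|: K -> g v = f1 v,
    {in L :|: K, forall v, g v \in A :\ a} &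
    {in L :|: K, forall v u, adj v u -> g v != g u}].
  apply: greedy_coloring_exists => v vN.
  have sN : L :|: K \subset M.
    by rewrite subUset sLM; apply/subsetP => x; rewrite inE => /andP[].
  have vM := subsetP sN v vN.
  have : #|A :\ a| > d by move: dA; rewrite (cardsD1 a A) aA.
  apply: leq_ltn_trans; rewrite -ltnS; apply: leq_trans (deg v vM).
  rewrite ltnS; apply: subset_leq_card.
  apply: subset_trans (subL f1 _ v (subsetUl L K) sN vM f1M).
  by apply/subsetP => u; rewrite !inE; case: ifP => // _ /and3P[-> _ ->].
have cgam : is_coloring gam.
  apply/is_coloringP => u v uv.
  have [uN|uN] := boolP (u \in L :|: K); first exact: gamp.
  have [vN|vN] := boolP (v \in L :|: K).
    by rewrite eq_sym; apply: gamp; rewrite // adj_sym.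
  by rewrite !gamf // pf1.
have gama : {in M, forall v, gam v \in A :\ a}.
  move=> v vM; have [/gamA//|vN] := boolP (v \in L :|: K).
  rewrite gamf // !inE f1A // andbT.
  by move: vN; rewrite !inE vM; apply: contra => ->; rewrite orbT.
(* Keeping [a] on [K] makes [gam1] agree with [f1] outside [L], so that [reach_paint_within] applies
   to [L]. *)
pose gam1 := [ffun v => if v \in K then a else gam v].
have KL v : v \in K -> v \notin L.
  by rewrite inE => /andP[_ /eqP fv]; apply/negP => /f1L; rewrite fv !inE eqxx.
have gam1f v : v \notin L -> f1 v = gam1 v.
  move=> vL; rewrite ffunE; case: ifPn => vK.
    by move: vK; rewrite inE => /andP[_ /eqP].
  by rewrite gamf // inE negb_or vL.
have indK : {in K &, forall u v, ~~ adj u v}.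
  move=> u v; rewrite !inE => /andP[_ /eqP fu] /andP[_ /eqP fv].
  by apply: contraTN isT => /pf1; rewrite fu fv eqxx.
have cgam1 : is_coloring gam1.
  apply: is_coloring_paint => // u uK v uv vK.
  have [vL|vL] := boolP (v \in L).
    by have := gama v (subsetP sLM v vL); rewrite !inE => /andP[].
  rewrite gamf; last by rewrite inE negb_or vL.
  rewrite eq_sym.
  by move: uK; rewrite inE => /andP[_ /eqP <-]; apply: pf1.
have [I domI] := dominates_exists L a f1.
have [cp1 reach2] : is_coloring (paint I a gam1) /\
    reach (#|L| * t.+1) f1 (paint I a gam1).
  apply: (@reach_paint_within d s0 t A L I a f1 gam1) => //.
  - split=> // v vL; have vM := subsetP sLM v vL.
    + exact: f1A.
    + by apply: leq_trans (lM v vM) _.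
    + by apply: leq_trans (deg v vM); rewrite ltnS subset_leq_card // subL.
  - by move=> v /f1L; rewrite !inE => /andP[].
  - move=> v vL; rewrite ffunE ifN ?gama ?(subsetP sLM) //.
    by apply: contraL vL; apply: KL.
have [sI indI IL _] := domI.
have cp : is_coloring (paint I a gam).
  apply: is_coloring_paint => // u uI v uv vI.
  have [vM|vM] := boolP (v \in M); first by have := gama v vM; rewrite !inE => /andP[].
  have vL : v \notin L by apply: contra vM; apply: (subsetP sLM).
  have vK : v \notin K by rewrite inE (negbTE vM).
  by rewrite gamf; [apply: (IL u)|rewrite inE negb_or vL].
exists gam; split=> //.
  move=> v vM; rewrite gamf ?f1M // !inE (negbTE vM) //.
have reach3 : reach #|K| (paint I a gam1) (paint I a gam).
  apply: reach_independent => // v vK; rewrite !ffunE (negbTE vK) //.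
have reach4 := reach_sym (reach_paint cgam cp indI).
(* Beyond the recursive cost, each vertex pays at most [t.+1] for the move of [L], one step for [K]
   and one for [I]: in all [t + 3]. *)
apply: reach_leq (reach_trans (reach_trans (reach_trans reach1 reach2) reach3) reach4).
have leL := subset_leq_card sLM.
have leI := leq_trans (subset_leq_card sI) leL.
have leK : #|K| <= #|M|.
  by apply: subset_leq_card; apply/subsetP => x; rewrite inE => /andP[].
rewrite mulSn mulnDr mulnDr.
have := leq_mul leL (leqnn t.+1); have := leq_mul leL (leqnn (s * (t + 3))).
rewrite mulnS; lia.
Qed.

(** Here [d] is the largest allowed number of back neighbors. The doubled term rids both colorings
    of [a]; the rest pays for painting [I], moving the other vertices and unpainting [I]. *)
Fixpoint recolor_bound d s := match d with
  | d'.+1 => (s * (recolor_bound d' s + 3)).*2 + (recolor_bound d' s).+2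
  | 0 => 1
  end.

Lemma within_reach_bound d s : within_reach d.+1 s (recolor_bound d s).
Proof.
elim: d => [|d IH] A M f g dA mf mg fg.
  have [cf fA lM deg] := mf; have [cg _ _ _] := mg; rewrite muln1.
  apply: reach_independent => // u v.
  (* Without back neighbors [M] is independent: of two adjacent vertices, one in the earlier or
     common layer would count the other. *)
  wlog luv : u v / l u <= l v.
    move=> H uM vM; case: (leqP (l u) (l v)) => [|/ltnW] le_uv; first exact: H.
    by rewrite adj_sym; apply: H.
  move=> uM vM; have := deg u uM; rewrite ltnS leqn0 cards_eq0 => /eqP/setP/(_ v).
  by rewrite !inE vM luv andbT => ->.
have [a aA] : exists a, a \in A by apply/card_gt0P; apply: leq_trans dA.
have [f' [cf' f'f f'A reachf]] := avoid_color IH (leqnn s) dA aA mf.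
have [g' [cg' g'g g'A reachg]] := avoid_color IH (leqnn s) dA aA mg.
(* The same [I] serves [f'] and [g']: domination depends only on colors outside [M], where they
   agree. *)
have [I domI] := dominates_exists M a f'.
have [_ fA lM deg] := mf.
have mf' : movable A M s d.+2 f'.
  split=> // v vM; first by have /setDP[] := f'A v vM.
  by rewrite (back_nbrs_eq _ _ f'f) deg.
have f'g' v : v \notin M -> f' v = g' v by move=> vM; rewrite f'f ?g'g ?fg.
have [cp reachp] : is_coloring (paint I a g') /\
    reach (#|M| * (recolor_bound d s).+1) f' (paint I a g').
  apply: (reach_paint_within IH dA aA mf') => // v /f'A.
  by rewrite !inE => /andP[].
have [sI indI _ _] := domI.
have reachI := reach_sym (reach_paint cg' cp indI).
apply: reach_leq (reach_trans (reach_trans (reach_trans reachf reachp) reachI)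
  (reach_sym reachg)).
rewrite [recolor_bound d.+1 s]/=; have := subset_leq_card sI.
rewrite -addnn !mulnDr !mulnS; lia.
Qed.

End Reach.

Lemma recolor_bound_poly d :
  exists c, forall s, 0 < s -> recolor_bound d s <= c * s ^ d.
Proof.
elim: d => [|d [c IH]]; first by exists 1.
(* With [t <= c * s ^ d], the terms [2 * s * t + t] give [3 * c] and [6 * s + 2] gives [8]. *)
exists (3 * c + 8) => s s0 /=; have := IH s s0; set t := recolor_bound d s => le_t.
have s1 : 1 <= s ^ d by rewrite expn_gt0 s0.
rewrite expnS; have h1 := leq_mul (leqnn s) le_t.
have h2 := leq_mul (leqnn s) s1; have h3 := leq_mul s0 (leqnn (c * s ^ d)).
nia.
Qed.

(** * Layers from the maximum average degree *)

Section Layers.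
Variable G : sgraph.
Implicit Type S : {set G}.

Lemma sum_degree_le S :
  \sum_(v in S) #|[set u in S | adj v u]|
    <= 2 * #|[set E in edges G | E \subset S]|.
Proof.
under eq_bigr => v _ do rewrite -sum1_card.
rewrite pair_big_dep /=.
(* Handshake: ordered adjacent pairs are grouped by their edge, at most two to each. *)
rewrite (partition_big (fun p : G * G => [set p.1; p.2])
  (mem [set E in edges G | E \subset S])) /=; last first.
  move=> [u v] /=; rewrite !inE => /and3P[uS vS uv].
  rewrite subUset !sub1set uS vS !andbT.
  by apply/existsP; exists u; apply/existsP; exists v; rewrite uv eqxx.
rewrite mulnC -sum_nat_const; apply: leq_sum => E.
rewrite !inE => /andP[/existsP[u /existsP[v /andP[uv /eqP->]]] _].
rewrite sum1_card; apply: (@leq_trans #|[set (u, v); (v, u)]|); last first.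
  by rewrite cards2; case: eqP.
apply: subset_leq_card; apply/subsetP => -[x y].
rewrite unfold_in /= !inE => /andP[/and3P[_ _ xy] /eqP/setP exy].
move: (exy x) (exy y) xy; rewrite !inE !eqxx orbT /=.
by move=> /esym/orP[]/eqP -> /esym/orP[]/eqP ->; rewrite ?adj_irrefl ?eqxx ?orbT.
Qed.

Local Open Scope ring_scope.
Variable R : realFieldType.

Definition high_degree d S : {set G} :=
  [set v in S | (d <= #|[set u in S | adj v u]|)%N].

(** The degrees inside [S] sum to at most twice the number of its edges, and the vertices of
    [high_degree d S] contribute at least [d] each. *)
Lemma high_degree_leq d S :
  d%:R * #|high_degree d S|%:R <= max_avg_degree G R * #|S|%:R.
Proof.
have [->|S0] := eqVneq S set0.
  rewrite cards0 mulr0 (_ : high_degree d set0 = set0) ?cards0 ?mulr0 //.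
  by apply/setP => v; rewrite !inE.
have Spos : 0 < #|S|%:R :> R by rewrite ltr0n card_gt0.
pose F := [set E in edges G | E \subset S].
have : (2 * #|F|)%:R / #|S|%:R <= max_avg_degree G R.
  apply: (@le_bigmax_cond _ _ _ _ (S, F) _
    (fun H : {set G} * {set {set G}} => (2 * #|H.2|)%:R / #|H.1|%:R : R)).
  apply/and3P; split=> //=.
    by apply/subsetP => E; rewrite inE => /andP[].
  by apply/forallP => E; apply/implyP; rewrite inE => /andP[].
rewrite ler_pdivrMr //; apply: le_trans; rewrite -natrM ler_nat.
apply: leq_trans (sum_degree_le S); rewrite mulnC -sum_nat_const.
rewrite [X in (_ <= X)%N](bigID (fun v => v \in high_degree d S)) /=.
apply: leq_trans (leq_addr _ _).
rewrite [X in (_ <= X)%N](eq_bigl (fun v => v \in high_degree d S)).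
  by apply: leq_sum => v; rewrite inE => /andP[].
by move=> v; rewrite inE; case: (v \in S).
Qed.

(** Low-degree vertices form layer 0 and the others are layered recursively, one layer higher. Each
    round keeps at most a fraction [q], so after [s] rounds fewer than one vertex, hence none,
    remains. *)
Lemma layering_exists d (q : R) : 0 <= q ->
  (forall S, #|high_degree d S|%:R <= q * #|S|%:R) ->
  forall s S, q ^+ s * #|S|%:R < 1 ->
  exists l : G -> nat, {in S, forall v, (l v < s)%N /\
    (#|[set u in S | adj v u && (l v <= l u)%N]| < d)%N}.
Proof.
move=> q0 high; elim=> [|s IH] S qS.
  exists (fun=> 0%N) => v vS; move: qS.
  rewrite mul1r ltrn1 ltnS leqn0 cards_eq0 => /eqP S0.
  by rewrite S0 inE in vS.
have [|l Hl] := IH (high_degree d S).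
  apply: le_lt_trans qS; rewrite exprSr -mulrA.
  by apply: ler_wpM2l; [apply: exprn_ge0|apply: high].
exists (fun v => if v \in high_degree d S then (l v).+1 else 0%N) => v vS.
have [vH|vH] := ifPn.
  have [lv dv] := Hl v vH; split=> //; apply: leq_ltn_trans dv.
  apply: subset_leq_card; apply/subsetP => u.
  rewrite inE => /and3P[uS uv].
  by case: ifPn => // uH luv; rewrite inE uH uv.
split=> //; move: vH; rewrite inE vS /= -ltnNge; apply: leq_ltn_trans.
by apply: subset_leq_card; apply/subsetP => u; rewrite !inE => /and3P[-> ->].
Qed.

End Layers.

(** * From recoloring sequences to the diameter *)

Section Distance.
Variable G : sgraph.

Lemma leq_bigminn (I : finType) (P : pred I) (F : I -> nat) x i :
  P i -> \big[minn/x]_(j | P j) F j <= F i.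
Proof.
move=> Pi; rewrite -big_filter.
have : i \in [seq j <- index_enum I | P j] by rewrite mem_filter Pi mem_index_enum.
elim: [seq _ <- _ | _] => // j r IH; rewrite inE big_cons => /orP[/eqP->|/IH].
  exact: geq_minl.
exact: leq_trans (geq_minr _ _).
Qed.

Lemma distance_leq (x y : G) p :
  path (@adj G) x p -> last x p = y -> distance x y <= size p.
Proof.
(* Without repeated vertices the walk has fewer than [#|G|] edges, so its length is in the range of
   the minimum. *)
move=> xp <-; case/shortenP: xp => q xq uq sq.
have ltq : size q < #|G| by move/card_uniqP: uq => /= <-; apply: max_card.
have leq_qp : size q <= size p.
  by apply: uniq_leq_size sq; case/andP: uq.
apply: leq_trans leq_qp.
apply: (@leq_bigminn _ _ (fun m : 'I_#|G| => m : nat) _ (Ordinal ltq)).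
by apply/existsP; exists (in_tuple q); rewrite xq eqxx.
Qed.
End Distance.

Lemma reach_recolor_path (G : sgraph) k m (f g : coloring G k) :
  reach m (val f) (val g) ->
  exists p : seq (coloring G k),
    [/\ path (@recolor G k) f p, last f p = g & size p <= m].
Proof.
have [f0 ef] : {f0 | f0 = val f} by exists (val f).
have [g0 eg] : {g0 | g0 = val g} by exists (val g).
rewrite -ef -eg => H; elim: H f g ef eg => {m f0 g0} [m f0|m f0 g0 h cf cg fg _ IH] f g.
  by move=> -> /val_inj ->; exists [::].
move=> ef eg; have [p [pp lp sp]] := IH (Sub g0 cg) g erefl eg.
exists (Sub g0 cg :: p); split=> //=; rewrite pp andbT /recolor -ef /=.
by rewrite fg.
Qed.

Lemma connected_diameter_leq (G : sgraph) k m (f0 : {ffun G -> 'I_k}) :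
  is_coloring f0 ->
  (forall f g : {ffun G -> 'I_k}, is_coloring f -> is_coloring g -> reach m f g) ->
  graph_connected (reconfiguration_graph G k) /\
  diameter (reconfiguration_graph G k) <= m.
Proof.
move=> cf0 H; split; first split.
- by apply/card_gt0P; exists (Sub f0 cf0 : coloring G k).
- move=> f g; have [p [fp lp _]] := reach_recolor_path (H _ _ (valP f) (valP g)).
  by apply/connectP; exists p.
- apply/bigmax_leqP => f _; apply/bigmax_leqP => g _.
  have [p [fp lp sp]] := reach_recolor_path (H _ _ (valP f) (valP g)).
  exact: leq_trans (@distance_leq (reconfiguration_graph G k) f g p fp lp) sp.
Qed.

Lemma reconfiguration_diameter_leq (G : sgraph) k d s (l : G -> nat) :
  d.+1 < k ->
  (forall v, l v < s /\ #|[set u | adj v u && (l v <= l u)]| < d.+1) ->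
  graph_connected (reconfiguration_graph G k) /\
  diameter (reconfiguration_graph G k) <= #|G| * recolor_bound d s.
Proof.
move=> dk Hl.
have dT : d.+1 < #|[set: 'I_k]| by rewrite cardsT card_ord.
have back (f : {ffun G -> 'I_k}) v : #|back_nbrs l [set: 'I_k] f [set: G] v| < d.+1.
  have [_] := Hl v; apply: leq_ltn_trans; apply: subset_leq_card.
  by apply/subsetP => u; rewrite !inE.
have k0 : 0 < k by apply: leq_trans dk.
(* The constant function is only a seed: every vertex is recolored greedily. The result shows that
   the reconfiguration graph is nonempty. *)
have [f0 [_ _ f0p]] := @greedy_coloring_exists G k l [set: 'I_k] [set: G]
  [ffun=> Ordinal k0] (fun v _ => leq_trans (back _ v) (ltnW dT)).
apply: (@connected_diameter_leq _ _ _ f0) => [|f g cf cg].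
  by apply/is_coloringP => u v uv; apply: f0p; rewrite ?inE.
rewrite -cardsT; apply: (within_reach_bound dT) => //.
- by split=> // v _; rewrite ?inE //; case: (Hl v).
- by split=> // v _; rewrite ?inE //; case: (Hl v).
- by move=> v; rewrite inE.
Qed.

(* Logarithmic number of layers and conclusion *)
From mathcomp Require Import all_classical all_reals all_analysis.
From mathcomp Require Import ring lra.
Local Open Scope ring_scope.

(** This follows from [1 - del <= expR (- del)]. *)
Lemma expr_lt1_of_ln_lt (R : realType) (del : R) (n s : nat) :
  0 <= 1 - del -> (0 < n)%N -> ln n%:R < del * s%:R ->
  (1 - del) ^+ s * n%:R < 1.
Proof.
move=> q0 n0 ln_lt; have n0R : 0 < n%:R :> R by rewrite ltr0n.
apply: (@le_lt_trans _ _ (expR (- (del * s%:R)) * n%:R)).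
  rewrite ler_pM2r // -mulNr expRM_natr lerXn2r ?nnegrE ?expR_ge0 //.
  exact: expR_ge1Dx.
by rewrite -{1}(lnK n0R) -expRD -[ltRHS]expR0 ltr_expR; lra.
Qed.

Theorem theorem1 (R : realType) (d k : nat) (hd : (1 <= d)%N) (hk : (1 <= k)%N)
    (hdk : (d + 1 <= k)%N) (eps : R) (heps : 0 < eps) :
  exists C : R, forall G : sgraph, (2 <= #|G|)%N ->
    max_avg_degree G R = d%:R - eps ->
    graph_connected (reconfiguration_graph G k) /\
    (diameter (reconfiguration_graph G k))%:R
      <= C * #|G|%:R * ln (#|G|%:R) ^+ (d - 1).
Proof.
(* From here on [d] is one less than in the statement, hence the exponent [d]. *)
case: d hd hdk => // d _ hdk; rewrite subn1 /=.
have [c hc] := recolor_bound_poly d.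
have d0 : 0 < d.+1%:R :> R by rewrite ltr0n.
(* Chosen so that the maximum average degree divided by [d.+1] is [1 - del]. *)
pose del : R := eps / d.+1%:R.
have del0 : 0 < del by rewrite divr_gt0.
have ln20 : 0 < ln 2%:R :> R by rewrite ln_gt0 // ltr1n.
(* The number of layers will be at most [ln n / del + 1], and [1 <= ln n / ln 2] absorbs the last
   term. *)
exists (c%:R * (del^-1 + (ln 2%:R)^-1) ^+ d) => G n2 mad.
have n0 : (0 < #|G|)%N := ltnW n2.
have ln_ge : ln 2%:R <= ln #|G|%:R :> R.
  by rewrite ler_ln ?posrE ?ltr0n // ler_nat.
have high (S : {set G}) : #|high_degree d.+1 S|%:R <= (1 - del) * #|S|%:R.
  have := high_degree_leq R d.+1 S; rewrite mad => H.
  by rewrite -(ler_pM2l d0) mulrA mulrBr mulr1 /del mulrCA mulfV ?mulr1 //.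
(* A large [eps] is excluded by the graph itself: the nonnegative number of its high-degree vertices
   is at most [(1 - del) * #|G|]. *)
have q0 : 0 <= 1 - del.
  have /(le_trans (ler0n _ _)) := high [set: G]%SET.
  by rewrite pmulr_lge0 // ltr0n cardsT.
set L := ln #|G|%:R : R.
pose s := (Num.truncn (L / del)).+1.
have s_gt : L < del * s%:R.
  by rewrite mulrC -ltr_pdivrMr // truncnS_gt.
have s_le : s%:R <= (del^-1 + (ln 2%:R)^-1) * L.
  rewrite /s -natr1 mulrDl; apply: lerD.
    rewrite [leRHS]mulrC truncn_le divr_ge0 //; last exact: ltW.
    exact: le_trans (ltW ln20) ln_ge.
  by rewrite [leRHS]mulrC ler_pdivlMr ?mul1r.
have [l Hl] : exists l : G -> nat, forall v, (l v < s)%N /\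
    (#|[set u | adj v u && (l v <= l u)%N]%SET| < d.+1)%N.
  have [|l Hl] := layering_exists q0 high (s := s) (S := [set: G]%SET).
    by rewrite cardsT; apply: expr_lt1_of_ln_lt.
  exists l => v; have [] := Hl v (finset.in_setT v) => lv dv; split=> //.
  apply: leq_ltn_trans dv; apply: subset_leq_card.
  by apply/fintype.subsetP => u; rewrite !inE.
have [|conn diam] := @reconfiguration_diameter_leq G k d s l _ Hl; first by lia.
split=> //; apply: (@le_trans _ _ (#|G| * (c * s ^ d))%:R).
  by rewrite ler_nat; apply: leq_trans diam _; rewrite leq_mul // hc.
rewrite !natrM natrX [leRHS](_ : _ =
  #|G|%:R * (c%:R * ((del^-1 + (ln 2%:R)^-1) * L) ^+ d)); last first.
  by rewrite exprMn; ring.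
by rewrite !ler_wpM2l // lerXn2r ?nnegrE // (le_trans _ s_le).
Qed.
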